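(* Let $0<q<1$ be fixed. For each $n\geq 1$ let $\lambda=(\lambda_1\geq\lambda_2\geq\cdots)$ be a random Young diagram of size $n$ distributed according to the $q$-Plancherel measure $M_{n,q}$. Then for every $i\geq 1$, as $n\to\infty$, $$\frac{\lambda_i}{n}\longrightarrow (1-q)\,q^{i-1}\quad\text{in probability.}$$
   Context: $\mathscr{Y}_n$ is the set of partitions (Young diagrams) $\lambda=(\lambda_1\geq\lambda_2\geq\cdots)$ of size $n$, with $\lambda_i=0$ for $i$ larger than the number of parts $\ell(\lambda)$; $\lambda'$ is the conjugate partition. For a box $\square=(i,j)$ in row $i$ and column $j$ of $\lambda$, the hook length is $h(\square)=\lambda_i-j+\lambda'_j-i+1$. Put $b(\lambda)=\sum_{i}(i-1)\lambda_i$ and $\{m\}_q=\frac{q^m-1}{q-1}=1+q+\cdots+q^{m-1}$. Let $\dim\lambda$ be the dimension of the irreducible representation of the symmetric group $\mathfrak{S}_n$ indexed by $\lambda$ (the number of standard Young tableaux of shape $\lambda$). The $q$-Plancherel measure is the probability measure on $\mathscr{Y}_n$ given by $$M_{n,q}(\lambda)=\dim\lambda\cdot\frac{q^{b(\lambda)}}{\prod_{\square\in\lambda}\{h(\square)\}_q}.$$ Convergence in probability of functions $X_n$ on $\mathscr{Y}_n$ to a constant $x$ means: for every $\delta>0$, $M_{n,q}[|X_n-x|\geq\delta]\to 0$ as $n\to\infty$. *)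

(* Defs.v *)
From HB Require Import structures.
From mathcomp Require Import all_boot all_order all_algebra.
From mathcomp Require Import all_classical all_reals all_analysis.

Set Implicit Arguments.
Unset Strict Implicit.
Unset Printing Implicit Defensive.

Import Order.TTheory GRing.Theory Num.Theory.
Import numFieldNormedType.Exports.

Local Open Scope classical_set_scope.
Local Open Scope ring_scope.

(* Rows, columns and boxes are numbered from 0.  A partition of n has at most
   n parts, each at most n; it is stored padded with zeros to length n. *)
Definition is_partition (n : nat) (t : n.-tuple 'I_n.+1) : bool :=
  sorted geq [seq nat_of_ord x | x <- t]
  && (sumn [seq nat_of_ord x | x <- t] == n).

Definition young (n : nat) : Type :=
  {t : n.-tuple 'I_n.+1 | is_partition t}.

Definition part (n : nat) (la : young n) (i : nat) : nat :=
  nth 0%N [seq nat_of_ord x | x <- val la] i.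

(* The index i ranges over 'I_n only, since all later parts vanish. *)
Definition conj_part (n : nat) (la : young n) (j : nat) : nat :=
  #|[pred i : 'I_n | (j < part la i)%N]|.

Definition box (n : nat) (la : young n) : Type :=
  {c : 'I_n * 'I_n | (c.2 < part la c.1)%N}.

Definition row_of (n : nat) (la : young n) (c : box la) : nat := (val c).1.
Definition col_of (n : nat) (la : young n) (c : box la) : nat := (val c).2.

(* Arm + leg + 1.  With 0-based coordinates the arm is la_i - (j+1) and the leg
   is la'_j - (i+1); neither subtraction truncates at a box of la. *)
Definition hook_length (n : nat) (la : young n) (c : box la) : nat :=
  ((part la (row_of c) - (col_of c).+1)
   + (conj_part la (col_of c) - (row_of c).+1)).+1.

Definition b_stat (n : nat) (la : young n) : nat :=
  (\sum_(i < n) i * part la i)%N.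

(* There are n boxes, so an injective filling by 'I_n is a bijection. *)
Definition is_standard (n : nat) (la : young n)
    (t : {ffun box la -> 'I_n}) : bool :=
  [&& injectiveb t,
      [forall c : box la, forall d : box la,
         ((row_of c == row_of d) && (col_of c < col_of d)%N)
           ==> (t c < t d)%N]
    & [forall c : box la, forall d : box la,
         ((col_of c == col_of d) && (row_of c < row_of d)%N)
           ==> (t c < t d)%N]].

(* dim la, as the number of standard Young tableaux of shape la. *)
Definition dim_young (n : nat) (la : young n) : nat :=
  #|[pred t : {ffun box la -> 'I_n} | is_standard t]|.

Definition qnum (R : realType) (q : R) (m : nat) : R :=
  (q ^+ m - 1) / (q - 1).

Definition q_plancherel (R : realType) (q : R) (n : nat) (la : young n) : R :=
  (dim_young la)%:R
  * (q ^+ b_stat la / \prod_(c : box la) qnum q (hook_length c)).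

Definition q_plancherel_pr (R : realType) (q : R) (n : nat)
    (A : pred (young n)) : R :=
  \sum_(la : young n | A la) q_plancherel q la.

Definition cvg_in_q_plancherel (R : realType) (q : R)
    (X : forall n : nat, young n -> R) (x : R) : Prop :=
  forall delta : R, 0 < delta ->
    (fun n : nat =>
       q_plancherel_pr q [pred la : young n | delta <= `|X n la - x|])
      @ \oo --> (0 : R).

(* Main.v *)
Require Import Defs.
From HB Require Import structures.
From mathcomp Require Import all_boot all_order all_algebra.
From mathcomp Require Import all_classical all_reals all_analysis.
From mathcomp Require Import ring lra zify.

Set Implicit Arguments.
Unset Strict Implicit.
Unset Printing Implicit Defensive.

Import Order.TTheory GRing.Theory Num.Theory.
Import numFieldNormedType.Exports.

Local Open Scope classical_set_scope.
Local Open Scope ring_scope.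

(** The q-Plancherel measures are the marginals of a growth process on Young
diagrams, and the theorem is a second moment estimate for that process.

A standard tableau of shape la is a ballot word, its k-th letter being the row
of the k-th box ([dim_young_ballot]), so the measure of size n is a sum over
ballot words w of the hook weight of the shape of w
([q_plancherel_expect]).  Put z_i = q^(la_i + N - i) for the rows i < N.  Up
to a constant the hook weight is a Vandermonde product in the z_i divided by
q-factorials ([weight_vandermonde]); hence adding a box to row i multiplies it
by
  p_i = (1 - q) / (1 - z_i) * prod_(j != i) (q z_i - z_j) / (z_i - z_j),
which vanishes when row i cannot grow ([weight_add_box],
[growth_prob_eq0]).  Partial fractions give sum_i p_i = 1, so the p_i are the
transition probabilities of a growth process ([expectS]).

Two drifts are computed.  Let x_j = (1 - q) q^j be the claimed limit of la_j / n,
so that sum_j x_j^2 = p2, with p2 = (1 - q) / (1 + q).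
- Deleting all rows from k on decreases each p_i with i < k, and in the
  truncated diagram row k receives the new box with probability at most q^k.
  So the new box falls in a row of index at least k with probability at most
  q^k, whatever the diagram ([growth_prob_head]).  By Abel summation
  E (sum_j j la_j) <= n q / (1 - q) and E (sum_j q^j la_j) >= n / (1 + q).
- The content of the box added at step m + 1 has expectation m p2.  Indeed,
  over two consecutive steps the contributions of a pair of boxes that can be
  added in either order cancel; what is left is a second partial fraction
  sum, with value p2, for every diagram ([content_drift_step]).  Since the sum
  of the contents is sum_j (la_j (la_j - 1) / 2 - j la_j), this gives
  E (sum_j la_j^2) = n^2 p2 + O(n) ([expect_sum_squares]).

Expanding the square,
  E sum_j (la_j / n - x_j)^2
    = n^-2 E (sum_j la_j^2) - 2 (1 - q) / n * E (sum_j q^j la_j) + sum_j x_j^2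
    <= p2 - 2 p2 + p2 + O(1 / n),
and Chebyshev's inequality concludes. *)

(** * Partial fractions *)

(** The sum is the coefficient of degree size s - 1 in the Lagrange interpolant
of P at s, and that interpolant is P itself, of smaller degree. *)
Lemma divided_difference_eq0 (F : fieldType) (s : seq F) (P : {poly F}) :
  uniq s -> (size P < size s)%N ->
  \sum_(x <- s) P.[x] / \prod_(y <- s | y != x) (x - y) = 0.
Proof.
move=> us sP.
pose l x := \prod_(y <- s | y != x) ('X - y%:P).
pose d x := \prod_(y <- s | y != x) (x - y).
have dl x : (l x).[x] = d x.
  by rewrite /l horner_prod; apply: eq_bigr => y _; rewrite hornerXsubC.
have d0 x : d x != 0.
  by rewrite /d prodf_seq_neq0; apply/allP => y _; apply/implyP; rewrite subr_eq0 eq_sym.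
have szl x : x \in s -> size (l x) = size s.
  move=> xs; rewrite /l -big_filter size_prod_XsubC size_filter.
  have := count_predC (pred1 x) s; rewrite count_uniq_mem // xs add1n => <-.
  by congr S; apply: eq_count => y /=.
have monl x : l x \is monic by rewrite /l monic_prod // => y _; rewrite monicXsubC.
pose L := \sum_(x <- s) (P.[x] / d x) *: l x.
have LP : L = P.
  apply/eqP; rewrite -subr_eq0; apply/eqP.
  apply: (@roots_geq_poly_eq0 _ _ s) => //; last first.
    apply: leq_trans (size_polyD _ _) _; rewrite geq_max size_polyN (ltnW sP) andbT.
    rewrite /L; apply: (leq_trans (size_sum _ _ _)); apply/bigmax_leqP_seq => x xs _.
    by apply: leq_trans (size_scale_leq _ _) _; rewrite szl.
  apply/allP => x xs; rewrite /root hornerD hornerN subr_eq0 /L horner_sum.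
  rewrite (bigD1_seq x) //= big1 => [|y yx].
    by rewrite addr0 hornerZ dl divfK.
  rewrite hornerZ; apply/eqP; rewrite mulf_eq0; apply/orP; right.
  rewrite /l horner_prod prodf_seq_eq0; apply/hasP; exists x => //=.
  by rewrite hornerXsubC subrr eqxx eq_sym yx.
have := congr1 (fun p : {poly F} => p`_(size s).-1) LP.
rewrite /= [in RHS]nth_default; last by case: (size s) sP.
move=> LP0; rewrite -[RHS]LP0 /L coef_sum; rewrite [LHS]big_seq [RHS]big_seq.
apply: eq_bigr => x xs; rewrite coefZ.
by rewrite -{1}(szl _ xs) -/(lead_coef _) (monicP (monl x)) mulr1.
Qed.

(** The divided difference of the polynomial prod_j (t X - z_j), of degree k,
at 0, the points of s and the z_i.  As s is not empty there are at least k + 2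
points.  Equivalently, the residues of
prod_j (t x - z_j) / (x - z_j) / (x prod_(a in s) (x - a)) sum to zero. *)
Lemma partial_fractions (F : fieldType) (k : nat) (z : 'I_k -> F) (t : F)
    (s : seq F) :
  injective z -> (forall i, z i \notin 0 :: s) -> uniq (0 :: s) ->
  (0 < size s)%N ->
  (t - 1) * (\sum_i (\prod_(j | j != i) ((t * z i - z j) / (z i - z j)))
               / \prod_(a <- s) (z i - a))
  + \sum_(a <- s) (\prod_j ((t * a - z j) / (a - z j)))
               / (a * \prod_(b <- s | b != a) (a - b))
  + (\prod_(a <- s) (- a))^-1 = 0.
Proof.
move=> zinj zs us s0.
pose P : {poly F} := \prod_(j < k) (t *: 'X - (z j)%:P).
have PE x : P.[x] = \prod_j (t * x - z j).
  by rewrite horner_prod; apply: eq_bigr => j _; rewrite !hornerE.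
have sP : (size P <= k.+1)%N.
  apply: leq_trans (size_prod_leq _ _) _.
  rewrite leq_subLR card_ord addnS ltnS.
  have -> : (k + k = \sum_(i < k) 2)%N by rewrite sum_nat_const card_ord muln2 addnn.
  apply: leq_sum => i _.
  apply: leq_trans (size_polyD _ _) _; rewrite geq_max size_polyN.
  rewrite (leq_trans (size_scale_leq _ _)) ?size_polyX //=.
  by rewrite (leq_trans (size_polyC_leq1 _)).
pose zz := [seq z i | i <- enum 'I_k].
have uzz : uniq ((0 :: s) ++ zz).
  rewrite cat_uniq us map_inj_uniq // enum_uniq andbT /=.
  by apply/hasPn => _ /mapP[i _ ->]; exact: zs.
have /(divided_difference_eq0 uzz) : (size P < size ((0%R :: s) ++ zz))%N.
  rewrite size_cat size_map size_enum_ord; apply: leq_ltn_trans sP _.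
  by rewrite /= addSn ltnS -add1n leq_add2r.
have z0 i : z i != 0 by have := zs i; rewrite inE negb_or => /andP[].
have zsa i a : a \in s -> z i != a.
  by move=> sa; apply: contraNneq (zs i) => ->; rewrite inE sa orbT.
have sa0 a : a \in s -> a != 0.
  by move=> sa; apply: contraTneq us => a0; rewrite /= -a0 sa.
have zi_row i : P.[z i] / \prod_(y <- (0 :: s) ++ zz | y != z i) (z i - y) =
   (t - 1) * ((\prod_(j | j != i) ((t * z i - z j) / (z i - z j)))
               / \prod_(a <- s) (z i - a)).
  rewrite PE (bigD1 i) //= big_cons /= eq_sym z0 subr0 big_cat /= big_map.
  rewrite big_enum_cond /= prodf_div.
  have -> : \prod_(j < k | z j != z i) (z i - z j) = \prod_(j | j != i) (z i - z j).
    by apply: eq_bigl => j; rewrite (inj_eq zinj).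
  have -> : \prod_(a <- s | a != z i) (z i - a) = \prod_(a <- s) (z i - a).
    rewrite big_seq_cond [RHS]big_seq; apply: eq_bigl => a.
    by case sa: (a \in s) => //=; rewrite eq_sym zsa.
  have d1 : \prod_(a <- s) (z i - a) != 0.
    rewrite prodf_seq_neq0; apply/allP => a sa; apply/implyP => _.
    by rewrite subr_eq0 zsa.
  have d2 : \prod_(j | j != i) (z i - z j) != 0.
    by apply/prodf_neq0 => j ji; rewrite subr_eq0 (inj_eq zinj) eq_sym.
  by field; rewrite d1 d2 z0.
have s_row a : a \in s -> P.[a] / \prod_(y <- (0 :: s) ++ zz | y != a) (a - y) =
   (\prod_j ((t * a - z j) / (a - z j))) / (a * \prod_(b <- s | b != a) (a - b)).
  move=> sa; rewrite PE big_cons /= eq_sym sa0 // subr0 big_cat /= big_map.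
  rewrite big_enum_cond /= prodf_div.
  have -> : \prod_(j < k | z j != a) (a - z j) = \prod_j (a - z j).
    by apply: eq_bigl => j; rewrite zsa.
  by rewrite !invfM; ring.
have row0 : P.[0] / \prod_(y <- (0 :: s) ++ zz | y != 0) (0 - y) =
   (\prod_(a <- s) (- a))^-1.
  rewrite PE big_cons /= eqxx /= big_cat /= big_map big_enum_cond /=.
  have -> : \prod_(j < k | z j != 0) (0 - z j) = \prod_j (t * 0 - z j).
    by apply: eq_big => [j|j _]; rewrite ?z0 ?mulr0.
  have -> : \prod_(a <- s | a != 0) (0 - a) = \prod_(a <- s) (- a).
    rewrite big_seq_cond [RHS]big_seq; apply: eq_big => [a|a _]; last exact: sub0r.
    by case sa: (a \in s) => //=; rewrite sa0.
  rewrite invfM mulrCA divff ?mulr1 //.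
  by apply/prodf_neq0 => j _; rewrite mulr0 sub0r oppr_eq0.
rewrite big_cat big_cons row0 /= [X in _ + X + _ = 0]big_seq (eq_bigr _ s_row) -big_seq.
have -> : \sum_(x <- zz) P.[x] / \prod_(y <- 0 :: s ++ zz | y != x) (x - y) =
  (t - 1) * (\sum_i (\prod_(j | j != i) ((t * z i - z j) / (z i - z j)))
               / \prod_(a <- s) (z i - a)).
  rewrite big_map big_enum big_distrr /=; apply: eq_bigr => i _; exact: zi_row.
by move=> H; rewrite -[RHS]H; ring.
Qed.

(** With z_i = q^(la_i + k - i) this is the probability that the next box is put
in row i of the diagram la with k rows. *)
Definition up_prob (F : fieldType) (q : F) (k : nat) (z : 'I_k -> F) (i : 'I_k) : F :=
  (1 - q) / (1 - z i) * \prod_(j | j != i) ((q * z i - z j) / (z i - z j)).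

(** Partial fractions with t = q and the single extra pole 1.  Some z_j equal to
q, which is an empty last row, makes the product vanish. *)
Lemma sum_up_prob (F : fieldType) (q : F) (k : nat) (z : 'I_k -> F) :
  injective z -> (forall i, z i != 0) -> (forall i, z i != 1) ->
  \sum_i up_prob q z i = 1 - \prod_j ((q - z j) / (1 - z j)).
Proof.
move=> zinj z0 z1.
have u01 : uniq [:: 0; 1 : F] by rewrite /= inE eq_sym oner_eq0.
have zs i : z i \notin [:: 0; 1] by rewrite !inE negb_or z0 z1.
have := partial_fractions q zinj zs u01 isT.
rewrite !big_cons !big_nil eqxx /= !mulr1 invrN invr1 addr0 mulr1.
rewrite big_distrr /= => /eqP; rewrite subr_eq0 addrC => /eqP.
move=> H; apply/eqP; rewrite eq_sym subr_eq addrC; apply/eqP.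
rewrite -[LHS]H; congr (_ + _); apply: eq_bigr => i _.
rewrite big_cons big_nil mulr1 /up_prob; field.
by rewrite !subr_eq0 z1 eq_sym z1.
Qed.

(** Partial fractions with t = q^2 and the extra poles 1 and 1/q.  The
conditions z_i = q^2 and z_i = q, met by two empty last rows, cancel their
residues. *)
Lemma sum_double_up_prob (F : fieldType) (q : F) (k : nat) (z : 'I_k -> F) :
  q != 0 -> q != 1 -> 1 + q != 0 ->
  injective z -> (forall i, z i != 0) -> (forall i, z i != 1) ->
  (forall i, q * z i != 1) -> (exists i, z i = q) -> (exists i, z i = q ^+ 2) ->
  \sum_i (1 - q) ^+ 2 / ((1 - z i) * (1 - q * z i)) *
     \prod_(j | j != i) ((q ^+ 2 * z i - z j) / (z i - z j)) = (1 - q) / (1 + q).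
Proof.
move=> q0 q1 q1' zinj z0 z1 zq [i1 zi1] [i2 zi2].
have u01 : uniq [:: 0; 1; q^-1].
  by rewrite /= !inE negb_or eq_sym oner_eq0 eq_sym invr_eq0 q0 eq_sym invr_eq1 q1.
have zs i : z i \notin [:: 0; 1; q^-1].
  by rewrite !inE !negb_or z0 z1 -(inj_eq (mulfI q0)) divff ?zq.
have := partial_fractions (q ^+ 2) zinj zs u01 isT.
have at1 : \prod_j ((q ^+ 2 * 1 - z j) / (1 - z j)) = 0.
  by rewrite (bigD1 i2) //= zi2 mulr1 subrr !mul0r.
have atV : \prod_j ((q ^+ 2 / q - z j) / (q^-1 - z j)) = 0.
  by rewrite (bigD1 i1) //= zi1 expr2 mulfK // subrr !mul0r.
rewrite !big_cons !big_nil /= at1 atV !mul0r !addr0.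
rewrite mulr1 mulrNN mul1r invrK => /eqP; rewrite addr_eq0 => /eqP H.
have q2 : q ^+ 2 - 1 != 0.
  have -> : q ^+ 2 - 1 = (q - 1) * (1 + q) by ring.
  by rewrite mulf_neq0 // subr_eq0.
move/(canRL (mulKf q2)): H => H.
have -> : (1 - q) / (1 + q) = (1 - q) ^+ 2 / q * ((q ^+ 2 - 1)^-1 * - q).
  by field; rewrite q1' q2 q0.
rewrite -H big_distrr /=; apply: eq_bigr => i _.
rewrite !big_cons big_nil mulr1.
field; rewrite q0 mulrC !subr_eq0 zq z1 (eq_sym 1 (z i)) z1.
by rewrite (eq_sym 1) zq.
Qed.

Definition bump_row (F : fieldType) (q : F) (k : nat) (z : 'I_k -> F) (i j : 'I_k) : F :=
  if j == i then q * z j else z j.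

(** * Two consecutive steps of the growth process *)
Section TwoSteps.
Variables (F : numFieldType) (q : F) (k : nat) (z : 'I_k -> F).
Hypotheses (zinj : injective z) (z0 : forall i, z i != 0) (z1 : forall i, z i != 1).
Hypothesis zq : forall i, q * z i != 1.

(** The probability of adding a box to rows i and then j is q * rest i j, which
is symmetric: both orders reach the same diagram. *)
Let rest (i j : 'I_k) : F :=
  (1 - q) / (1 - z i) * ((1 - q) / (1 - z j)) *
  \prod_(l | (l != i) && (l != j))
     ((q * z i - z l) / (z i - z l) * ((q * z j - z l) / (z j - z l))).

(** The rational function giving the probability of adding two boxes to row i,
when no z_j equals q z_i. *)
Let double (i : 'I_k) : F :=
  (1 - q) ^+ 2 / ((1 - z i) * (1 - q * z i)) *
  \prod_(j | j != i) ((q ^+ 2 * z i - z j) / (z i - z j)).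

Let zB i j : j != i -> z i - z j != 0.
Proof. by move=> ji; rewrite subr_eq0 (inj_eq zinj) eq_sym. Qed.

Let restC i j : rest i j = rest j i.
Proof.
rewrite /rest; congr (_ * _); first by rewrite mulrC.
by apply: eq_big => [l|l _]; [rewrite andbC|rewrite mulrC].
Qed.

(** The equality q z_i = z_j means that rows i and j = i - 1 have the same
length, so that row i cannot grow first. *)
Lemma two_steps_neq i j : j != i ->
  up_prob q z i * up_prob q (bump_row q z i) j =
  if q * z i == z j then 0 else q * rest i j.
Proof.
move=> ji; case: eqP => [qz|/eqP qz].
  by rewrite /up_prob (bigD1 j) //= qz subrr !mul0r mulr0 mul0r.
rewrite /rest big_split /=.
set A := \prod_(_ | _) _; set B := \prod_(_ | _) _.
have -> : up_prob q z i = (1 - q) / (1 - z i) * ((q * z i - z j) / (z i - z j) * A).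
  by rewrite /up_prob (bigD1 j).
have -> : up_prob q (bump_row q z i) j =
    (1 - q) / (1 - z j) * ((q * z j - q * z i) / (z j - q * z i) * B).
  rewrite /up_prob /bump_row (negPf ji) (bigD1 i) /=; last by rewrite eq_sym.
  rewrite eqxx.
  congr (_ * (_ * _)); apply: eq_big => [l|l /andP[_ /negPf-> //]].
  by rewrite andbC.
have nj : z j - q * z i != 0 by rewrite subr_eq0 eq_sym.
field; rewrite nj zB //=.
by rewrite !subr_eq0 ![1 == _]eq_sym !z1.
Qed.

(** If row i cannot grow because q z_i = z_j, then the left side vanishes while
double i = - q * rest i j; this term will cancel the missing order of the
vertical domino with boxes in rows j and i. *)
Lemma two_steps_eq i :
  up_prob q z i * up_prob q (bump_row q z i) i =
  double i + \sum_(j | (j != i) && (q * z i == z j)) q * rest i j.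
Proof.
have U1 : up_prob q (bump_row q z i) i = (1 - q) / (1 - q * z i) *
    \prod_(j | j != i) ((q ^+ 2 * z i - z j) / (q * z i - z j)).
  rewrite /up_prob /bump_row eqxx; congr (_ * _).
  by apply: eq_bigr => j /negPf->; rewrite expr2 mulrA.
case: (pickP (fun j => (j != i) && (q * z i == z j))) => [j /andP[ji /eqP qz]|none].
  rewrite (big_pred1 j) => [|l /=]; last first.
    rewrite qz (inj_eq zinj) [j == l]eq_sym.
    by case: (altP (l =P j)) => [->|_]; rewrite ?ji ?andbF.
  rewrite /up_prob (bigD1 j) //= qz subrr !mul0r mulr0 mul0r.
  apply/esym/eqP; rewrite addr_eq0; apply/eqP.
  rewrite /double /rest (bigD1 j) //= -qz expr2.
  set A := \prod_(_ | _) _; set B := \prod_(_ | _) _.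
  have -> : B = A.
    rewrite /B (eq_bigr (fun l => (q * q * z i - z l) / (z i - z l))) => [|l /andP[li lj]].
      by [].
    have nl : q * z i - z l != 0 by rewrite qz zB // eq_sym.
    by field; rewrite zB // nl.
  have zi0 := z0 i.
  have zij : z i - q * z i != 0 by rewrite qz zB.
  field; rewrite zij /= !subr_eq0 ![1 == _]eq_sym z1 zq //.
rewrite big_pred0 // addr0 U1 /up_prob /double.
rewrite mulrACA -big_split /= mulf_div -expr2; congr (_ * _).
apply: eq_bigr => j ji; field; rewrite zB //=.
by rewrite subr_eq0; have := none j; rewrite ji /= => ->.
Qed.

(** Here c i is the content of the next box of row i, which increases by one
once that box is added.  The terms (c j - c i) * rest i j with i != j are
antisymmetric and sum to zero, provided that both orders are present for each
pair; the orders excluded because q z_i = z_j are supplied by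
[two_steps_eq]. *)
Lemma two_steps_drift (c : 'I_k -> F) :
  (forall i j, q * z i = z j -> c j = c i + 1) ->
  \sum_i up_prob q z i *
     (\sum_j up_prob q (bump_row q z i) j * (c j + (j == i)%:R - c i)) =
  \sum_i double i.
Proof.
move=> hc.
pose T i j := rest i j * (c j - c i).
have T0 : \sum_i \sum_(j | j != i) q * T i j = 0.
  set S := \sum_i _; suff SN : S = - S.
    have /eqP : S *+ 2 = 0 by rewrite mulr2n {1}SN addNr.
    by rewrite mulrn_eq0 => /eqP.
  rewrite {1}/S (exchange_big_dep xpredT) //= -sumrN; apply: eq_bigr => i _.
  rewrite -sumrN; apply: eq_big => [j|j _]; first by rewrite eq_sym.
  by rewrite /T restC; ring.
have row i : up_prob q z i *
   (\sum_j up_prob q (bump_row q z i) j * (c j + (j == i)%:R - c i)) =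
   double i + \sum_(j | j != i) q * T i j.
  rewrite (bigD1 i) //= eqxx [c i + _ - _]addrAC subrr add0r mulr1.
  rewrite mulrDr two_steps_eq -addrA; congr (_ + _).
  rewrite big_distrr /= big_mkcondr /= -big_split /=; apply: eq_bigr => j ji.
  rewrite (negPf ji) addr0 mulrA two_steps_neq // /T.
  case: eqP => [/hc->|_]; last by rewrite add0r mulrA.
  by rewrite mul0r addr0 addrAC subrr add0r mulr1.
by under eq_bigr do rewrite row; rewrite big_split /= T0 addr0.
Qed.

End TwoSteps.

(** * The growth process *)

(** Diagrams are functions from row indices to row lengths, so that they can
grow without change of type. *)
Definition nonincreasing_rows (la : nat -> nat) : Prop :=
  forall i, (la i.+1 <= la i)%N.

Lemma rows_leq (la : nat -> nat) i j :
  nonincreasing_rows la -> (i <= j)%N -> (la j <= la i)%N.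
Proof.
move=> hla /subnKC <-; elim: (j - i)%N => [|d IH]; first by rewrite addn0.
by rewrite addnS; apply: leq_trans (hla _) IH.
Qed.

Definition add_box (la : nat -> nat) (i : nat) : nat -> nat :=
  fun j => (la j + (j == i))%N.

Definition addable (la : nat -> nat) (i : nat) : bool :=
  (i == 0)%N || (la i < la i.-1)%N.

Lemma add_box_nonincreasing la i : nonincreasing_rows la -> addable la i ->
  nonincreasing_rows (add_box la i).
Proof.
rewrite /addable /add_box => hla ai j; have := hla j.
case: (j.+1 =P i) => [ji|/eqP/negPf ji]; last by case: (j =P i); lia.
by move: ai; rewrite -ji /=; case: eqP; lia.
Qed.

Section Growth.
Variables (R : realFieldType) (q : R).
Hypotheses (q_gt0 : 0 < q) (q_lt1 : q < 1).

(** The exponent is the shifted row length for k rows, plus one. *)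
Definition row_power (k : nat) (la : nat -> nat) (i : nat) : R :=
  q ^+ (la i + (k - i)).

Definition growth_prob (k : nat) (la : nat -> nat) (i : nat) : R :=
  (1 - q) / (1 - row_power k la i) *
  \prod_(j < k | (j : nat) != i)
     ((q * row_power k la i - row_power k la j)
        / (row_power k la i - row_power k la j)).

Lemma growth_probE k la (i : 'I_k) :
  growth_prob k la i = up_prob q (fun j : 'I_k => row_power k la j) i.
Proof. by []. Qed.

Lemma powq_lt m n : (m < n)%N -> q ^+ n < q ^+ m.
Proof. by move=> mn; rewrite ltr_iXn2l. Qed.

Lemma powq_le m n : (m <= n)%N -> q ^+ n <= q ^+ m.
Proof. by move=> mn; rewrite ler_iXn2l. Qed.

Lemma row_power_neq0 k la i : row_power k la i != 0.
Proof. by rewrite expf_neq0 // gt_eqF. Qed.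

Lemma row_power_lt1 k la i : (i < k)%N -> row_power k la i < 1.
Proof. by move=> ik; rewrite exprn_ilt1 ?ltW // addn_eq0 negb_and subn_eq0 -ltnNge ik orbT. Qed.

Lemma row_power_neq1 k la i : (i < k)%N -> row_power k la i != 1.
Proof. by move=> ik; rewrite lt_eqF ?row_power_lt1. Qed.

Lemma row_power_lt k la i j : nonincreasing_rows la ->
  (i < j)%N -> (j < k)%N -> row_power k la i < row_power k la j.
Proof.
move=> hla ij jk; apply: powq_lt; have := rows_leq hla (ltnW ij); lia.
Qed.

Lemma row_power_inj k la : nonincreasing_rows la ->
  injective (fun i : 'I_k => row_power k la i).
Proof.
move=> hla i j /= e; apply/val_inj => /=; case: (ltngtP i j) => // ij.
- by have := row_power_lt hla ij (ltn_ord j); rewrite e ltxx.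
- by have := row_power_lt hla ij (ltn_ord i); rewrite e ltxx.
Qed.

Lemma row_powerS k la i : (i <= k)%N -> row_power k.+1 la i = q * row_power k la i.
Proof. by move=> ik; rewrite /row_power subSn // addnS exprS. Qed.

Lemma sum_growth_prob k la : nonincreasing_rows la ->
  \sum_(i < k) growth_prob k la i =
  1 - \prod_(j < k) ((q - row_power k la j) / (1 - row_power k la j)).
Proof.
move=> hla; under eq_bigr do rewrite growth_probE.
apply: sum_up_prob => [|i|i]; first exact: row_power_inj.
  exact: row_power_neq0.
exact: row_power_neq1.
Qed.

Lemma sum_growth_prob1 k la : nonincreasing_rows la -> la k = 0%N ->
  \sum_(i < k.+1) growth_prob k.+1 la i = 1.
Proof.
move=> hla lak; rewrite sum_growth_prob // big_ord_recr /=.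
have -> : row_power k.+1 la k = q by rewrite /row_power lak subSnn expr1.
by rewrite subrr mul0r mulr0 subr0.
Qed.

Lemma growth_prob_ge0 k la i : nonincreasing_rows la -> (i < k)%N ->
  0 <= growth_prob k la i.
Proof.
move=> hla ik; have zi1 := row_power_lt1 la ik.
apply: mulr_ge0; first by rewrite divr_ge0 // subr_ge0 ltW.
apply: prodr_ge0 => j ji.
case: (ltngtP j i) ji => // ij _.
  have zji := row_power_lt hla ij ik.
  rewrite divr_ge0 ?subr_ge0 //; last exact: ltW.
  rewrite /row_power -exprS powq_le //.
  have := rows_leq hla (ltnW ij); lia.
have zij := row_power_lt hla ij (ltn_ord j).
rewrite -mulrNN -invrN !opprB divr_ge0 ?subr_ge0 //; last exact: ltW.
apply: ltW.
by apply: le_lt_trans zij; rewrite ler_piMl ?ltW // exprn_gt0.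
Qed.

(** With u = z_i and y = q^(la_k), taking row k into account multiplies p_i by
(1 - u) (y - q u) / ((1 - q u) (y - u)), and the difference between numerator
and denominator is u (1 - q) (1 - y), which is nonnegative.  The common shift
z -> q z of the rows j < k cancels in the factors of the product. *)
Lemma growth_prob_mono k la i : nonincreasing_rows la -> (i < k)%N ->
  growth_prob k la i <= growth_prob k.+1 la i.
Proof.
move=> hla ik; have zi1 := row_power_lt1 la ik.
pose u := row_power k la i; pose y := q ^+ la k.
have u0 : 0 < u by rewrite exprn_gt0.
have uy : u < y.
  by apply: powq_lt; have := rows_leq hla (ltnW ik); lia.
have qu : q * u < u by rewrite gtr_pMl.
have y1 : y <= 1 by rewrite exprn_ile1 // ltW.
have Hq : growth_prob k.+1 la i =
   growth_prob k la i * ((1 - u) * (y - q * u) / ((1 - q * u) * (y - u))).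
  rewrite /growth_prob (bigD1 ord_max) /=; last by rewrite gtn_eqF.
  have -> : row_power k.+1 la i = q * u by rewrite row_powerS // ltnW.
  have -> : row_power k.+1 la k = q * y by rewrite row_powerS // /row_power subnn addn0.
  rewrite -/u.
  set A := \prod_(_ < k.+1 | _) _; set B := \prod_(_ < k | _) _.
  have -> : A = B.
    rewrite /A big_mkcond big_ord_recr /= eqxx andbF mulr1 [RHS]big_mkcond.
    apply: eq_bigr => j _ /=; case: eqP => //= /eqP ji.
    rewrite row_powerS 1?ltnW // -/u; set v := row_power k la j.
    have uv : u - v != 0.
      rewrite subr_eq0; apply: contra ji => /eqP uv; apply/eqP.
      exact: congr1 (@row_power_inj k la hla j (Ordinal ik) (esym uv)).
    have uv' : q * u - q * v != 0 by rewrite -mulrBr mulf_neq0 // gt_eqF.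
    have -> : widen_ord (leqnSn k) j != ord_max by rewrite -val_eqE /= ltn_eqF.
    by field; rewrite uv uv'.
  have nuy : u - y != 0 by rewrite subr_eq0 lt_eqF.
  have nuy' : q * u - q * y != 0 by rewrite -mulrBr mulf_neq0 // gt_eqF.
  have n1 : 1 - u != 0 by rewrite subr_eq0 gt_eqF.
  have n2 : 1 - q * u != 0 by rewrite subr_eq0 gt_eqF // (lt_trans qu).
  have n3 : y - u != 0 by rewrite subr_eq0 gt_eqF.
  by field; rewrite n1 n2 n3 nuy'.
rewrite Hq ler_peMr ?growth_prob_ge0 //.
rewrite ler_pdivlMr ?mul1r; last by rewrite mulr_gt0 // subr_gt0 // (lt_trans qu).
have : 0 <= u * ((1 - q) * (1 - y)) by rewrite !mulr_ge0 ?subr_ge0 // ltW.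
lra.
Qed.

(** Truncating to k rows decreases each term by [growth_prob_mono].  For the
truncated diagram the sum is 1 - prod_(j < k) (q - z_j) / (1 - z_j), where
each of the k factors is at most q. *)
Lemma growth_prob_head k N la : nonincreasing_rows la -> (k <= N)%N ->
  1 - q ^+ k <= \sum_(i < k) growth_prob N la i.
Proof.
move=> hla /subnKC <-.
apply: (@le_trans _ _ (\sum_(i < k) growth_prob k la i)).
  rewrite sum_growth_prob // lerD2l lerN2.
  rewrite -[k in X in _ <= X]card_ord -prodr_const; apply: ler_prod => j _.
  have z1 := row_power_lt1 la (ltn_ord j).
  have z0 : 0 < row_power k la j by rewrite exprn_gt0.
  have zq : row_power k la j <= q.
    by rewrite -[leRHS]expr1 powq_le //; have := ltn_ord j; lia.
  apply/andP; split; first by rewrite divr_ge0 ?subr_ge0 // ltW.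
  rewrite ler_pdivrMr ?subr_gt0 // mulrBr mulr1 lerD2l lerN2.
  by rewrite ler_piMl // ltW.
apply: ler_sum => i _; elim: (N - k)%N => [|d IH]; first by rewrite addn0.
apply: le_trans IH _; rewrite addnS growth_prob_mono //.
by rewrite (leq_trans (ltn_ord i)) // leq_addr.
Qed.

Lemma abel_sum (a g : nat -> R) N :
  \sum_(i < N.+1) a i * g i =
  (\sum_(i < N.+1) a i) * g N
  - \sum_(k < N) (\sum_(i < k.+1) a i) * (g k.+1 - g k).
Proof.
elim: N => [|N IH]; first by rewrite !big_ord_recl !big_ord0 subr0 !addr0.
rewrite big_ord_recr /= IH [in RHS]big_ord_recr /= [in X in _ = _ - X]big_ord_recr /=.
by ring.
Qed.

(** Among the laws satisfying [growth_prob_head], the expectation of the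
nondecreasing function g of the row is largest for the one whose tails are
exactly the q^k with k <= N. *)
Lemma growth_drift_le N la (g : nat -> R) : nonincreasing_rows la -> la N = 0%N ->
  {homo g : i j / (i <= j)%N >-> i <= j} ->
  \sum_(i < N.+1) growth_prob N.+1 la i * g i <=
  g 0%N + \sum_(k < N) q ^+ k.+1 * (g k.+1 - g k).
Proof.
move=> hla laN hg; rewrite abel_sum sum_growth_prob1 // mul1r.
have -> : g 0%N = g N - \sum_(k < N) (g k.+1 - g k).
  by rewrite -(big_mkord xpredT (fun k => g k.+1 - g k)) telescope_sumr //; ring.
rewrite -addrA lerD2l addrC -sumrN -sumrN -big_split /=.
apply: ler_sum => k _.
have := growth_prob_head (k := k.+1) (N := N.+1) hla (ltnW (ltn_ord k)).
have : 0 <= g k.+1 - g k by rewrite subr_ge0 hg.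
nra.
Qed.

Lemma growth_drift_row N la : nonincreasing_rows la -> la N = 0%N ->
  \sum_(i < N.+1) growth_prob N.+1 la i * i%:R <= q / (1 - q).
Proof.
move=> hla laN; apply: le_trans (growth_drift_le hla laN _) _.
  by move=> i j ij; rewrite ler_nat.
rewrite add0r ler_pdivlMr ?subr_gt0 //.
suff -> : (\sum_(k < N) q ^+ k.+1 * (k.+1%:R - k%:R)) * (1 - q) = q - q ^+ N.+1.
  by rewrite gerBl exprn_ge0 ?ltW.
elim: (N) => [|n IH]; first by rewrite big_ord0 expr1 subrr mul0r.
by rewrite big_ord_recr /= mulrDl IH -natrB // subSnn !exprS; ring.
Qed.

Lemma growth_drift_power N la : nonincreasing_rows la -> la N = 0%N ->
  1 / (1 + q) <= \sum_(i < N.+1) growth_prob N.+1 la i * q ^+ i.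
Proof.
move=> hla laN.
have := growth_drift_le (g := fun i => - q ^+ i) hla laN.
rewrite /= => /(_ _)/le_trans H.
rewrite -lerN2 -sumrN; under eq_bigr do rewrite -mulrN.
apply: H; first by move=> i j ij; rewrite lerN2 powq_le.
rewrite expr0.
have q1' : 0 < 1 + q by rewrite addr_gt0.
suff H : (\sum_(k < N) q ^+ k.+1 * (- q ^+ k.+1 - - q ^+ k)) * (1 + q) = q - q ^+ N * q ^+ N * q.
  rewrite -(ler_pM2r q1') mulrDl H !mulNr !mul1r mulVf ?gt_eqF //.
  have : 0 <= q ^+ N * q ^+ N * q by rewrite !mulr_ge0 // ?exprn_ge0 // ltW.
  lra.
elim: (N) => [|n IH]; first by rewrite big_ord0 expr0 !mul1r subrr mul0r.
by rewrite big_ord_recr /= mulrDl IH !exprS; ring.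
Qed.

(** If rows i - 1 and i have the same length, then the factor q z_i - z_(i - 1)
vanishes. *)
Lemma growth_prob_eq0 k la i : nonincreasing_rows la -> (i < k)%N ->
  ~~ addable la i -> growth_prob k la i = 0.
Proof.
case: i => [|i] hla ik; rewrite /addable //= -leqNgt => li.
have lai : la i = la i.+1 by apply/eqP; rewrite eqn_leq li hla.
rewrite /growth_prob (bigD1 (Ordinal (ltnW ik))) /=; last by rewrite ltn_eqF.
have -> : row_power k la i = q * row_power k la i.+1.
  by rewrite /row_power lai -exprS; congr (q ^+ _); lia.
by rewrite subrr !mul0r mulr0.
Qed.

Lemma powq_inj : injective (fun n => q ^+ n).
Proof.
move=> m n /= e; case: (ltngtP m n) => // /powq_lt; by rewrite e ltxx.
Qed.

(** The expected content of the next box, as adding a box to row j of la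
creates content la j - j. *)
Definition content_drift (k : nat) (la : nat -> nat) : R :=
  \sum_(j < k) growth_prob k la j * ((la j)%:R - j%:R).

Lemma growth_prob_add_box k la (i j : 'I_k) :
  growth_prob k (add_box la i) j =
  up_prob q (bump_row q (fun l : 'I_k => row_power k la l) i) j.
Proof.
have e : row_power k (add_box la i) \o val =1
         bump_row q (fun l : 'I_k => row_power k la l) i.
  move=> l; rewrite /= /bump_row /row_power /add_box val_eqE.
  by case: (l == i); rewrite ?addn0 // addn1 addSn exprS.
rewrite growth_probE /up_prob -!e; congr (_ * _).
by apply: eq_bigr => l _; rewrite -!e.
Qed.

(** The expected content of the new box grows by the same amount at each step,
whatever the diagram.  For the harmonic function s_la(x), with
x_j = (1 - q) q^j, this is the identity
p_2 s_la = sum of (+ or -) s_mu over the mu obtained from la by adding a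
horizontal (+) or vertical (-) domino. *)
Lemma content_drift_step N la : nonincreasing_rows la ->
  la N = 0%N -> la N.+1 = 0%N ->
  \sum_(i < N.+2) growth_prob N.+2 la i * content_drift N.+2 (add_box la i) =
  content_drift N.+2 la + (1 - q) / (1 + q).
Proof.
move=> hla laN laN1; set k := N.+2.
pose z (i : 'I_k) := row_power k la i.
have zlt i : z i < 1 by apply: row_power_lt1.
have z0 i : 0 < z i by apply: exprn_gt0.
have q0 : q != 0 by rewrite gt_eqF.
have q1 : q != 1 by rewrite lt_eqF.
have q1' : 1 + q != 0 by rewrite gt_eqF // addr_gt0.
have zn0 i : z i != 0 by rewrite gt_eqF.
have zn1 i : z i != 1 by rewrite lt_eqF.
have znq i : q * z i != 1 by rewrite lt_eqF // mulr_ilt1 // ltW.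
have zinj : injective z by exact: row_power_inj.
pose c (i : 'I_k) : R := (la i)%:R - (i : nat)%:R.
have hc i j : q * z i = z j -> c j = c i + 1.
  rewrite /z /row_power -exprS => /powq_inj; rewrite /c => e.
  have e' : (la j + i = la i + j + 1)%N by have := ltn_ord i; have := ltn_ord j; lia.
  have : (la j)%:R + (i : nat)%:R = (la i)%:R + (j : nat)%:R + 1 :> R.
    by rewrite -!natrD e' !natrD.
  lra.
have := two_steps_drift zinj zn0 zn1 znq hc.
rewrite (sum_double_up_prob q0 q1 q1' zinj zn0 zn1 znq); last 2 first.
- exists ord_max; by rewrite /z /row_power laN1 subSnn expr1.
- by exists (Ordinal (ltnW (ltnSn N.+1))); rewrite /z /row_power /= laN subSn ?subSnn.
move=> <-; rewrite /content_drift -big_split /=; apply: eq_bigr => i _.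
have [ai|nai] := boolP (addable la i); last first.
  by rewrite -[up_prob _ _ _]growth_probE growth_prob_eq0 // !mul0r addr0.
rewrite -[up_prob _ _ _]growth_probE -mulrDr; congr (_ * _).
(* A box in the last row would end the validity of sum_i p_i = 1. *)
have iN : (i : nat) != N.+1.
  by apply: contraTneq ai => ->; rewrite /addable /= laN laN1.
have := sum_growth_prob1 (k := N.+1) (add_box_nonincreasing hla ai).
rewrite {1}/add_box laN1 eq_sym (negPf iN) => /(_ erefl) S1.
rewrite -[X in _ = X + _]mul1r -[X in _ = X * _ + _]S1 mulr_suml -big_split /=.
apply: eq_bigr => j _.
rewrite -growth_prob_add_box -mulrDr; congr (_ * _).
by rewrite /c /add_box /= natrD val_eqE; ring.
Qed.

End Growth.

(** * Hook lengths and the weight of a diagram *)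
Section Hooks.
Local Open Scope nat_scope.
Variables (k : nat) (la : nat -> nat).

Definition column_length (j : nat) : nat := #|[pred i : 'I_k | j < la i]|.

Definition hook (i j : nat) : nat :=
  ((la i - j.+1) + (column_length j - i.+1)).+1.

Definition shifted_row (i : nat) : nat := la i + (k - i.+1).

Hypothesis hla : nonincreasing_rows la.

Lemma card_ord_ltn m : m <= k -> #|[pred i : 'I_k | i < m]| = m.
Proof.
move=> mk; rewrite -sum1_card -(big_ord_widen k (fun=> 1) mk).
by rewrite sum_nat_const card_ord muln1.
Qed.

Lemma column_length_leq j : column_length j <= k.
Proof. by rewrite -[leqRHS]card_ord max_card. Qed.

Lemma ltn_column_length m j : m < k -> (m < column_length j) = (j < la m).
Proof.
move=> mk; apply/idP/idP => [|jm].
  apply: contraLR; rewrite -!leqNgt => mj.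
  rewrite -[leqRHS]card_ord_ltn; last exact: ltnW.
  apply/subset_leq_card/fintype.subsetP => i; rewrite !inE => ji.
  rewrite ltnNge; apply: contraTN ji => mi; rewrite -leqNgt.
  exact: leq_trans (rows_leq hla mi) mj.
rewrite -[ltnLHS]card_ord_ltn; last exact: ltnW.
apply: proper_card; apply/fintype.properP; split.
  apply/fintype.subsetP => i; rewrite !inE => im.
  exact: leq_trans jm (rows_leq hla (ltnW im)).
by exists (Ordinal mk); rewrite !inE //= ltnn.
Qed.

Lemma shifted_row_lt i m : i < m -> m < k -> shifted_row m < shifted_row i.
Proof. by move=> im mk; have := rows_leq hla (ltnW im); rewrite /shifted_row; lia. Qed.

(** The hooks of row i and the differences of shifted row lengths fill
1, ..., shifted_row i.  Both families have distinct entries in this range and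
their sizes add up to its length.  Writing col for column_length, they are
disjoint because la i + col j - i - j - 1 = la i - i - la m + m would give
col j - j - 1 = m - la m, which fails both when j < la m, as then m < col j,
and when la m <= j, as then col j <= m. *)
Lemma hook_row_perm i : i < k ->
  perm_eq ([seq hook i j | j <- iota 0 (la i)] ++
           [seq shifted_row i - shifted_row m | m <- iota i.+1 (k - i.+1)])
          (iota 1 (shifted_row i)).
Proof.
move=> ik; set s := (s in perm_eq s _).
have col_mono j j' : j <= j' -> column_length j' <= column_length j.
  move=> jj'; apply/subset_leq_card/fintype.subsetP => x; rewrite !inE.
  exact: leq_ltn_trans.
have us : uniq s.
  rewrite cat_uniq !map_inj_in_uniq ?iota_uniq ?andbT /=; first last.
  - move=> j j'; rewrite !mem_iota /= !add0n /hook => jl jl' e.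
    wlog jj' : j j' jl jl' e / j <= j' => [H|].
      by case/orP: (leq_total j j') => jj'; [|symmetry]; apply: H.
    have := col_mono _ _ jj'; move: e.
    have := ltn_column_length j ik; have := ltn_column_length j' ik.
    lia.
  - move=> m m'; rewrite !mem_iota subnKC // => /andP[im mk] /andP[im' mk'] e.
    have h1 := shifted_row_lt im mk; have h2 := shifted_row_lt im' mk'.
    case: (ltngtP m m') => // mm'.
      by have := shifted_row_lt mm' mk'; lia.
    by have := shifted_row_lt mm' mk; lia.
  apply/hasPn => _ /mapP[m + ->]; rewrite mem_iota subnKC // => /andP[im mk].
  apply/mapP => -[j]; rewrite mem_iota /= add0n => jl e.
  have h1 := shifted_row_lt im mk.
  have ci : i < column_length j by rewrite ltn_column_length.
  have cm := ltn_column_length j mk.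
  move: e cm; rewrite /hook /shifted_row in h1 *.
  by case: (ltnP j (la m)) => ? ? ?; lia.
have sub : {subset s <= iota 1 (shifted_row i)}.
  move=> x; rewrite mem_cat mem_iota => /orP[] /mapP[m] + ->.
    rewrite mem_iota /= add0n => jl; have := column_length_leq m.
    have : i < column_length m by rewrite ltn_column_length.
    by rewrite /hook /shifted_row; lia.
  rewrite mem_iota subnKC // => /andP[im mk].
  by have := shifted_row_lt im mk; lia.
have [| _ es] := uniq_min_size us sub.
  by rewrite size_cat !size_map !size_iota.
by apply: uniq_perm; rewrite ?iota_uniq.
Qed.

End Hooks.

Section Vandermonde.
Variables (R : fieldType) (q : R) (k : nat) (z : 'I_k -> R).
Hypothesis zinj : injective z.

Definition vandermonde_prod (y : 'I_k -> R) : R :=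
  \prod_(a < k) \prod_(b < k | (a < b)%N) (y b - y a).

(** Only the factors with an index equal to i change; for both positions of i
in the pair (a, b) the change is (q z_i - z_j) / (z_i - z_j), with j the other
index. *)
Lemma vandermonde_bump i :
  vandermonde_prod (bump_row q z i) =
  vandermonde_prod z * \prod_(j | j != i) ((q * z i - z j) / (z i - z j)).
Proof.
pose g j := (q * z i - z j) / (z i - z j).
pose r a b := if a == i then g b else if b == i then g a else 1.
have zB a b : a != b -> z a - z b != 0 by rewrite subr_eq0 (inj_eq zinj).
have e : vandermonde_prod (bump_row q z i) =
    vandermonde_prod z * \prod_(a < k) \prod_(b < k | (a < b)%N) r a b.
  rewrite -big_split; apply: eq_bigr => a _; rewrite -big_split.
  apply: eq_bigr => b ab; rewrite /= /bump_row /r /g.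
  have nab : b != a by rewrite -val_eqE /= gtn_eqF.
  case: (eqVneq a i) => [ai|_].
    have bi : b != i by rewrite -ai.
    by rewrite (negPf bi) ai; field; rewrite zB // eq_sym.
  case: (eqVneq b i) => [bi|_]; last by rewrite mulr1.
  by rewrite bi; field; rewrite zB // -bi.
rewrite e; congr (_ * _).
rewrite [LHS](bigD1 i) //= [RHS](bigID (fun j : 'I_k => (i < j)%N) (fun j => j != i)) /=.
congr (_ * _).
  apply: eq_big => [b|b _]; last by rewrite /r eqxx.
  by rewrite andb_idl // => ib; rewrite -val_eqE /= gtn_eqF.
rewrite big_mkcondr; apply: eq_bigr => a ai /=.
have [ia|] := ltnP i a.
  rewrite big1 // => b ab; rewrite /r (negPf ai) ifN // -val_eqE /= gtn_eqF //.
  exact: ltn_trans ia ab.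
rewrite leq_eqVlt val_eqE (negPf ai) /= => lai.
rewrite (bigD1 i) //= big1 => [|b /andP[_ bi]].
  by rewrite /r (negPf ai) eqxx mulr1.
by rewrite /r (negPf ai) (negPf bi).
Qed.

End Vandermonde.

Section Weight.
Variables (R : realFieldType) (q : R).
Hypotheses (q_gt0 : 0 < q) (q_lt1 : q < 1).

(** This is (1 - q)^n s_la(1, q, q^2, ...) for a diagram with n boxes and at
most k rows. *)
Definition weight (k : nat) (la : nat -> nat) : R :=
  (1 - q) ^+ (\sum_(i < k) la i)%N *
  \prod_(i < k) (q ^+ (i * la i) / \prod_(j < la i) (1 - q ^+ hook k la i j)).

Lemma subr_powq_gt0 n : (0 < n)%N -> 0 < 1 - q ^+ n.
Proof. by move=> n0; rewrite subr_gt0 exprn_ilt1 ?ltW // -lt0n. Qed.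

Lemma weight_ge0 k la : 0 <= weight k la.
Proof.
apply: mulr_ge0; first by rewrite exprn_ge0 // subr_ge0 ltW.
apply: prodr_ge0 => i _; apply: divr_ge0; first by rewrite exprn_ge0 // ltW.
by apply: prodr_ge0 => j _; rewrite ltW // subr_powq_gt0.
Qed.

Lemma weight0 k : weight k (fun=> 0%N) = 1.
Proof.
rewrite /weight big1 // mul1r big1 // => i _.
by rewrite muln0 big_ord0 divr1.
Qed.

Lemma prod_row_hooks k la i : nonincreasing_rows la -> (i < k)%N ->
  (\prod_(j < la i) (1 - q ^+ hook k la i j)) *
  \prod_(m < k | (i < m)%N) (1 - q ^+ (shifted_row k la i - shifted_row k la m)) =
  \prod_(x < shifted_row k la i) (1 - q ^+ x.+1).
Proof.
move=> hla ik.
set l := shifted_row k la i.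
have iota0 n (F : nat -> R) : \prod_(x <- iota 0 n) F x = \prod_(x < n) F x.
  by rewrite -(big_mkord xpredT) /index_iota subn0.
have iotaS (F : nat -> R) :
    \prod_(m <- iota i.+1 (k - i.+1)) F m = \prod_(m < k | (i < m)%N) F m.
  by rewrite -(big_mkord (fun m => (i < m)%N)) [LHS](@big_nat_widenl _ _ _ i.+1 0).
have iota1 n (F : nat -> R) : \prod_(x <- iota 1 n) F x = \prod_(x < n) F x.+1.
  by rewrite (iotaDl 1 0) big_map iota0.
have := perm_big _ (hook_row_perm hla ik) : \prod_(x <- _) (1 - q ^+ x) = _.
by rewrite big_cat /= !big_map iota0 iotaS iota1.
Qed.

Definition weight_const (k : nat) : R := \prod_(m < k) (q ^+ (m * (k - m)))^-1.

(** By [prod_row_hooks] the hooks of row i contribute factors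
1 - q^(l_i - l_m) = (z_m - z_i) / z_m for m > i.  Collecting the powers z_m^-m
together with q^(m la_m) leaves only a constant, by the choice of the exponent
of z_m. *)
Lemma weight_vandermonde k la : nonincreasing_rows la ->
  weight k la = weight_const k * (1 - q) ^+ (\sum_(i < k) la i)%N *
    vandermonde_prod (fun i : 'I_k => row_power q k la i) /
    \prod_(i < k) \prod_(x < shifted_row k la i) (1 - q ^+ x.+1).
Proof.

move=> hla; rewrite [weight_const k * _]mulrC -!mulrA; congr (_ * _); rewrite mulrA.
have z0 i : row_power q k la i != 0 by rewrite expf_neq0 // gt_eqF.
pose z i := row_power q k la i; rewrite -/z.
have rowE (i : 'I_k) : q ^+ (i * la i) / \prod_(j < la i) (1 - q ^+ hook k la i j) =
    q ^+ (i * la i) * \prod_(m < k | (i < m)%N) (z m)^-1 *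
    \prod_(m < k | (i < m)%N) (z m - z i) /
    \prod_(x < shifted_row k la i) (1 - q ^+ x.+1).
  rewrite -(prod_row_hooks hla (ltn_ord i)).
  set D := \prod_(m < k | _) (1 - _).
  have DE : D = \prod_(m < k | (i < m)%N) (z m)^-1 * \prod_(m < k | (i < m)%N) (z m - z i).
    rewrite -big_split; apply: eq_bigr => m im /=.
    apply: (mulfI (z0 m)); rewrite mulVKf ?z0 //.
    rewrite mulrBr mulr1 -exprD; congr (_ - q ^+ _).
    have := rows_leq hla (ltnW im); have := ltn_ord m.
    by rewrite /shifted_row; lia.
  have D0 : D != 0.
    apply/prodf_neq0 => m im; rewrite gt_eqF // subr_powq_gt0 //.
    by rewrite subn_gt0 shifted_row_lt.
  have H0 : \prod_(j < la i) (1 - q ^+ hook k la i j) != 0.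
    by apply/prodf_neq0 => j _; rewrite gt_eqF // subr_powq_gt0.
  rewrite -[q ^+ _ * _ * _]mulrA -DE.
  by field; rewrite D0 H0.
rewrite (eq_bigr _ (fun i _ => rowE i)) !big_split /= prodfV.
congr (_ * _ * _).
rewrite (exchange_big_dep xpredT) //= -big_split /= /weight_const.
apply: eq_bigr => m _ /=.
rewrite prodr_const -(@eq_card _ [pred i : 'I_k | (i < m)%N]) // card_ord_ltn ?(ltnW (ltn_ord m)) //.
rewrite /z /row_power exprVn -exprM mulnDl exprD.
have ne n : q ^+ n != 0 by rewrite expf_neq0 // gt_eqF.
by rewrite [(m * la m)%N]mulnC [(m * (k - m))%N]mulnC; field; rewrite !ne.
Qed.

(** Adding the box multiplies z_i by q, multiplies the q-factorial of row i by
1 - z_i, and leaves the other rows unchanged. *)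
Lemma weight_add_box k la (i : 'I_k) : nonincreasing_rows la -> addable la i ->
  weight k (add_box la i) = weight k la * growth_prob q k la i.
Proof.
move=> hla ai; have hla' := add_box_nonincreasing hla ai.
rewrite !weight_vandermonde //.
have sumE : (\sum_(j < k) add_box la i j = (\sum_(j < k) la j).+1)%N.
  rewrite big_split /= -addn1; congr (_ + _)%N.
  by rewrite (bigD1 i) //= eqxx big1 // => j /negPf; rewrite -val_eqE => /= ->.
have -> : vandermonde_prod (fun j : 'I_k => row_power q k (add_box la i) j) =
    vandermonde_prod (bump_row q (fun j : 'I_k => row_power q k la j) i).
  have e j : row_power q k (add_box la i) (j : 'I_k) =
           bump_row q (fun l : 'I_k => row_power q k la l) i j.
    rewrite /bump_row /row_power /add_box val_eqE.
    by case: (j == i); rewrite ?addn0 // addn1 addSn exprS.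
  by apply: eq_bigr => a _; apply: eq_bigr => b _; rewrite !e.
rewrite vandermonde_bump; last exact: row_power_inj.
rewrite [\prod_(j < k) \prod_(x < shifted_row k (add_box _ _) _) _](bigD1 i) //=.
rewrite [\prod_(j < k) \prod_(x < shifted_row k la _) _](bigD1 i) //=.
have -> : shifted_row k (add_box la i) i = (shifted_row k la i).+1.
  by rewrite /shifted_row /add_box eqxx addn1 addSn.
rewrite big_ord_recr /=.
have -> : \prod_(j < k | j != i) \prod_(x < shifted_row k (add_box la i) j) (1 - q ^+ x.+1) =
    \prod_(j < k | j != i) \prod_(x < shifted_row k la j) (1 - q ^+ x.+1).
  apply: eq_bigr => j ji; have -> // : shifted_row k (add_box la i) j = shifted_row k la j.
  by rewrite /shifted_row /add_box val_eqE (negPf ji) addn0.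
have Q0 n : \prod_(x < n) (1 - q ^+ x.+1) != 0.
  by apply/prodf_neq0 => x _; rewrite gt_eqF // subr_powq_gt0.
set Q := \prod_(x < _) _; set Q' := \prod_(j < k | _) _.
have Q'0 : Q' != 0 by apply/prodf_neq0 => j _.
have -> : q ^+ (shifted_row k la i).+1 = row_power q k la i.
  by rewrite /row_power /shifted_row -addnS -subSn.
rewrite sumE exprS growth_probE /up_prob.
have z1 : 1 - row_power q k la i != 0 by rewrite subr_eq0 eq_sym row_power_neq1.
by field; rewrite z1 Q'0 Q0.
Qed.
End Weight.

(** * Ballot words and standard tableaux *)
Section Words.
Local Open Scope nat_scope.

Definition rows (w : seq nat) : nat -> nat := fun i => count_mem i w.

(** Reading letters as row indices, each letter adds a box that keeps the shape
a diagram. *)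
Definition ballot (w : seq nat) : bool :=
  all (fun k => addable (rows (take k w)) (nth 0 w k)) (iota 0 (size w)).

Lemma rows_rcons w x : rows (rcons w x) = add_box (rows w) x.
Proof.
by apply/funext => i; rewrite /rows /add_box -cats1 count_cat /= addn0 eq_sym.
Qed.

Lemma ballot_rcons w x : ballot (rcons w x) = ballot w && addable (rows w) x.
Proof.
rewrite /ballot size_rcons -addn1 iotaD all_cat /= add0n andbT.
rewrite nth_rcons ltnn eqxx -cats1 take_size_cat //; congr (_ && _).
apply: eq_in_all => k; rewrite mem_iota /= add0n => kw.
by rewrite nth_cat kw takel_cat // ltnW.
Qed.

Lemma ballotP w : reflect
  (forall k, k < size w -> addable (rows (take k w)) (nth 0 w k)) (ballot w).
Proof.
apply: (iffP allP) => h k; first by move=> kw; apply: h; rewrite mem_iota.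
by rewrite mem_iota /= => /h.
Qed.

Lemma ballot_rows w : ballot w -> nonincreasing_rows (rows w).
Proof.
elim/last_ind: w => [|w x IH] //; rewrite ballot_rcons rows_rcons => /andP[/IH].
exact: add_box_nonincreasing.
Qed.

Lemma ballot_take w m : ballot w -> ballot (take m w).
Proof.
move=> /ballotP bw; apply/ballotP => k; rewrite size_take_min leq_min => /andP[km kw].
by rewrite nth_take // take_takel ?(ltnW km) // bw.
Qed.

Lemma ballot_rows_eq0 w i : ballot w -> size w <= i -> rows w i = 0.
Proof.
elim/last_ind: w i => [|w x IH] // i; rewrite ballot_rcons rows_rcons size_rcons.
move=> /andP[/IH bw ax] wi; rewrite /add_box bw ?(ltnW wi) //.
case: eqP => // ix; move: ax; rewrite -ix /addable.
by rewrite (bw i.-1) ?ltn0 ?orbF; lia.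
Qed.

Lemma sum_rows N w : all (fun x => x < N) w -> \sum_(i < N) rows w i = size w.
Proof.
elim/last_ind: w => [|w x IH]; first by rewrite big1.
rewrite all_rcons rows_rcons size_rcons => /andP[xN /IH <-].
rewrite /add_box big_split /= -addn1; congr addn.
rewrite (bigD1 (Ordinal xN)) //= eqxx big1 // => j; rewrite -val_eqE /= => /negPf->.
by [].
Qed.

Lemma rows_take_leq w m m' i : m <= m' -> rows (take m w) i <= rows (take m' w) i.
Proof.
move=> /subnKC<-; rewrite takeD /rows count_cat; exact: leq_addr.
Qed.

Lemma rows_take_lt w m m' : m < m' -> m < size w ->
  rows (take m w) (nth 0 w m) < rows (take m' w) (nth 0 w m).
Proof.
move=> mm' mw; apply: leq_trans (rows_take_leq _ _ mm').
by rewrite (take_nth 0) // rows_rcons /add_box eqxx addn1.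
Qed.

(** A position is determined by its letter and the number of earlier copies of
that letter; this is how boxes are recovered from entries. *)
Lemma rows_take_inj w m m' : m < size w -> m' < size w -> nth 0 w m = nth 0 w m' ->
  rows (take m w) (nth 0 w m) = rows (take m' w) (nth 0 w m') -> m = m'.
Proof.
move=> mw m'w e; case: (ltngtP m m') => // mm'.
  by have := rows_take_lt mm' mw; rewrite e => /ltn_eqF/eqP.
by have := rows_take_lt mm' m'w; rewrite e => /gtn_eqF/eqP.
Qed.

Definition letters (m N : nat) (w : m.-tuple 'I_N) : seq nat := [seq val x | x <- w].

Lemma size_letters m N (w : m.-tuple 'I_N) : size (letters w) = m.
Proof. by rewrite size_map size_tuple. Qed.

Lemma nth_letters m N (w : m.-tuple 'I_N) (k : 'I_m) : nth 0 (letters w) k = tnth w k.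
Proof. by rewrite (nth_map (tnth w k)) ?size_tuple // -tnth_nth. Qed.

Lemma letters_lt m N (w : m.-tuple 'I_N) : all (fun x => x < N) (letters w).
Proof. by rewrite all_map; apply/allP => x _ /=. Qed.

Lemma rows_take_letters m N (w : m.-tuple 'I_N) l i :
  rows (take l (letters w)) i =
  #|[pred k : 'I_m | (k < l) && (tnth w k == i :> nat)]|.
Proof.
have tk : take l (enum 'I_m) = [seq k : 'I_m <- enum 'I_m | k < l].
  apply: (inj_map val_inj); rewrite map_take val_enum_ord.
  rewrite -(filter_map val (fun k => k < l)) val_enum_ord.
  have [ml|lm] := leqP m l.
    rewrite take_oversize ?size_iota //; apply/esym/all_filterP.
    by apply/allP => k; rewrite mem_iota /= => /leq_trans; apply.
  by rewrite take_iota (minn_idPl (ltnW lm)) -(filter_iota_ltn 0 (ltnW lm)).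
rewrite /rows /letters -map_tnth_enum -map_comp -map_take count_map tk.
rewrite -size_filter -filter_predI cardE enumT size_filter.
rewrite [RHS]size_filter; apply: eq_count => k /=; rewrite inE /= andbC.
by [].
Qed.

Lemma rows_letters_full m N (w : m.-tuple 'I_N) : take m (letters w) = letters w.
Proof. by rewrite take_oversize // size_letters. Qed.

End Words.

Section Tableaux.
Local Open Scope nat_scope.
Variables (n : nat) (la : young n).

Lemma part_nonincreasing : nonincreasing_rows (part la).
Proof.
move=> i; rewrite /part; case/andP: (valP la) => srt _.
set s := [seq _ | _ <- _] in srt *.
have [si|si] := ltnP i.+1 (size s); last by rewrite nth_default.
by move/(sortedP 0): srt => /(_ i si).
Qed.

Lemma part_leq i : part la i <= n.
Proof.
rewrite /part; have [si|si] := ltnP i (size (val la)); last by rewrite nth_default ?size_map.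
by rewrite (nth_map ord0) // -ltnS.
Qed.

Lemma part_eq0 i : n <= i -> part la i = 0.
Proof. by move=> ni; rewrite /part nth_default // size_map size_tuple. Qed.

Lemma sum_part : \sum_(i < n) part la i = n.
Proof.
case/andP: (valP la) => _ /eqP e; rewrite -[RHS]e sumnE (big_nth 0) size_map size_tuple.
by rewrite big_mkord.
Qed.

Lemma box_eq (c d : box la) : row_of c = row_of d -> col_of c = col_of d -> c = d.
Proof.
by case: c d => [[i j] h] [[i' j'] h'] /= /val_inj/= e /val_inj/= e'; apply/val_inj; rewrite /= e e'.
Qed.

Lemma box_exists i j : j < part la i -> exists c : box la, row_of c = i /\ col_of c = j.
Proof.
move=> ji.
have ni : i < n by rewrite ltnNge; apply: contraTN ji => /part_eq0->.
have nj : j < n := leq_trans ji (part_leq i).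
by exists (exist _ (Ordinal ni, Ordinal nj) ji).
Qed.

Lemma col_lt (c : box la) : col_of c < part la (row_of c).
Proof. exact: valP c. Qed.

Lemma card_row_prefix i j : j <= part la i ->
  #|[pred c : box la | (row_of c == i) && (col_of c < j)]| = j.
Proof.
move=> ji; set A := (X in #|X|).
have nj : j <= n := leq_trans ji (part_leq i).
rewrite -[RHS](card_ord_ltn nj) -(@card_in_image _ _ (fun c : box la => (val c).2) A).
  apply: eq_card => k; rewrite [RHS]inE; apply/fintype.imageP/idP => [[c]|kj].
    by rewrite inE => /andP[_ cj] ->.
  have [c [ci ck]] := box_exists (leq_trans kj ji).
  by exists c; [rewrite inE ci ck eqxx|apply/val_inj].
move=> c d; rewrite !inE => /andP[/eqP ci _] /andP[/eqP di _] e.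
by apply: box_eq; [rewrite ci di|by rewrite /col_of e].
Qed.

Lemma card_box : #|{: box la}| = n.
Proof.
rewrite -[RHS]sum_part -sum1_card.
rewrite (partition_big (fun c : box la => (val c).1) xpredT) //=.
apply: eq_bigr => i _; rewrite sum1_card -[RHS](card_row_prefix (leqnn _)).
apply: eq_card => c; rewrite [RHS]inE [LHS](_ : _ = (row_of c == i :> nat)) //.
by case: eqP => //= <-; rewrite col_lt.
Qed.

(** The default value k is never used when t is a bijection. *)
Definition word_of (t : {ffun box la -> 'I_n}) : n.-tuple 'I_n :=
  mktuple (fun k => if [pick c | t c == k] is Some c then (val c).1 else k).

Lemma tnth_word_of (t : {ffun box la -> 'I_n}) c : injective t ->
  tnth (word_of t) (t c) = (val c).1.
Proof.
move=> tinj; rewrite tnth_mktuple; case: pickP => [d /eqP/tinj->//|/(_ c)].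
by rewrite eqxx.
Qed.

Section StandardTableau.
Variable t : {ffun box la -> 'I_n}.
Hypothesis tstd : is_standard t.

Let w := letters (word_of t).

Let tinj : injective t.
Proof. by case/and3P: tstd => /injectiveP. Qed.

Let tsurj k : exists c, t c = k.
Proof.
have [|g _ gK] := inj_card_bij tinj; first by rewrite card_ord card_box.
by exists (g k).
Qed.

Let trow c d : row_of c = row_of d -> (t c < t d) = (col_of c < col_of d).
Proof.
have H x y : row_of x = row_of y -> col_of x < col_of y -> t x < t y.
  case/and3P: tstd => _ /forallP/(_ x)/forallP/(_ y)/implyP h _ e xy.
  by apply: h; rewrite e eqxx.
move=> e; case: (ltngtP (col_of c) (col_of d)) => cd; first exact: H.
  by apply/negbTE; rewrite -leqNgt ltnW // H.
by rewrite (box_eq e cd) ltnn.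
Qed.

Let tcol c d : col_of c = col_of d -> row_of c < row_of d -> t c < t d.
Proof.
case/and3P: tstd => _ _ /forallP/(_ c)/forallP/(_ d)/implyP h e cd.
by apply: h; rewrite e eqxx.
Qed.

Lemma nth_word_of c : nth 0 w (t c) = row_of c.
Proof. by rewrite nth_letters tnth_word_of. Qed.

Lemma rows_word_of m i :
  rows (take m w) i = #|[pred c : box la | (row_of c == i) && (t c < m)]|.
Proof.
rewrite rows_take_letters -(fintype.card_image tinj).
apply: eq_card => k; rewrite [LHS]inE; have [c <-] := tsurj k.
rewrite fintype.mem_image // inE andbC /=; congr (_ && _).
by rewrite tnth_word_of.
Qed.

(** In its row, the boxes with smaller entries than c are those on its left. *)
Lemma rows_word_of_box c : rows (take (t c) w) (row_of c) = col_of c.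
Proof.
rewrite rows_word_of -[RHS](card_row_prefix (ltnW (col_lt c))).
by apply: eq_card => d; rewrite !inE; case: eqP => //= /trow.
Qed.

Lemma rows_word_of_full i : rows w i = part la i.
Proof.
rewrite -[w]rows_letters_full rows_word_of -[RHS](card_row_prefix (leqnn _)).
apply: eq_card => d; rewrite !inE; case: eqP => //= <-.
by rewrite ltn_ord col_lt.
Qed.

(** The box above a box of entry k has a smaller entry, so the upper row is
strictly longer just before k is placed. *)
Lemma word_of_ballot : ballot w.
Proof.
apply/ballotP => k; rewrite size_letters => kn.
have [c ck] := tsurj (Ordinal kn).
have -> : k = t c by rewrite ck.
rewrite nth_word_of /addable rows_word_of_box.
case ci : (row_of c) => [|i] //=.
have [d [di dc]] : exists d : box la, row_of d = i /\ col_of d = col_of c.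
  apply: box_exists; have := col_lt c; rewrite ci => /leq_trans; apply.
  exact: part_nonincreasing.
have dlt : t d < t c by apply: tcol => //; rewrite di ci.
have := rows_take_lt dlt (_ : t d < size w).
by rewrite size_letters ltn_ord nth_word_of rows_word_of_box di dc => /(_ isT).
Qed.

End StandardTableau.

Lemma word_of_inj : {in [pred t | is_standard t] &, injective word_of}.
Proof.
move=> t t'; rewrite !inE => st st' e; apply/ffunP => c; apply/ord_inj.
apply: (@rows_take_inj (letters (word_of t))); rewrite ?size_letters //.
  by rewrite nth_word_of // e nth_word_of.
by rewrite nth_word_of // rows_word_of_box // e nth_word_of // rows_word_of_box.
Qed.

(** Position k of w is sent to the box in row w_k whose column is the number of
earlier copies of w_k.  This map is injective between sets of size n, and its
inverse is the tableau: rows increase by construction, columns because every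
prefix of w has a diagram as its shape. *)
Lemma word_of_surj (w : n.-tuple 'I_n) : ballot (letters w) ->
  (forall i : 'I_n, rows (letters w) i = part la i) ->
  exists2 t, is_standard t & word_of t = w.
Proof.
move=> bw rw; pose s := letters w.
have /fin_all_exists[b hb] (k : 'I_n) :
    exists c : box la, row_of c = tnth w k /\ col_of c = rows (take k s) (tnth w k).
  apply: box_exists; rewrite -rw -[in ltnRHS](rows_letters_full w) -nth_letters.
  by apply: rows_take_lt; rewrite ?size_letters.
have binj : injective b.
  move=> k k' e; apply/ord_inj; apply: (@rows_take_inj s); rewrite ?size_letters //.
    by rewrite !nth_letters; have [<- _] := hb k; have [<- _] := hb k'; rewrite e.
  by rewrite !nth_letters; have [_ <-] := hb k; have [_ <-] := hb k'; rewrite e.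
have [|g bK gK] := inj_card_bij binj; first by rewrite card_ord card_box.
have hg c : nth 0 s (g c) = row_of c /\ rows (take (g c) s) (row_of c) = col_of c.
  have [hr hc] := hb (g c); rewrite gK in hr hc.
  by rewrite nth_letters hc hr.
have gs c : g c < size s by rewrite size_letters.
pose t := [ffun c => g c].
have ginj : injective g := can_inj gK.
have tinj : injective t by move=> c d; rewrite !ffunE => /ginj.
exists t; last first.
  apply: eq_from_tnth => k; have := tnth_word_of (b k) tinj; rewrite ffunE bK => ->.
  by apply/ord_inj; have [] := hb k.
apply/and3P; split; first exact/injectiveP.
  apply/forallP => c; apply/forallP => d; apply/implyP => /andP[/eqP e cd].
  rewrite !ffunE ltnNge; apply: contraL cd => dc; rewrite -leqNgt.
  have [rc cc] := hg c; have [rd cd] := hg d.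
  by rewrite -cc -cd e rows_take_leq.
apply/forallP => c; apply/forallP => d; apply/implyP => /andP[/eqP e cd].
rewrite !ffunE; have [rc cc] := hg c; have [rd dd] := hg d.
have ncd : g c != g d.
  by apply: contraTneq cd => /ginj->; rewrite ltnn.
suff : g c < (g d).+1 by rewrite ltnS leq_eqVlt val_eqE (negPf ncd).
rewrite ltnNge; apply/negP => dc.
have h1 := rows_take_lt (ltnSn (g d)) (gs d).
have := rows_leq (ballot_rows (ballot_take (g d).+1 bw)) (ltnW cd).
have := rows_take_leq s (row_of c) dc.
rewrite rd dd in h1; rewrite cc -/s; lia.
Qed.

Lemma dim_young_ballot :
  dim_young la =
  #|[pred w : n.-tuple 'I_n | ballot (letters w) &&
      [forall i : 'I_n, rows (letters w) i == part la i]]|.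
Proof.
rewrite /dim_young -(card_in_image word_of_inj); apply: eq_card => w.
rewrite [RHS]inE; apply/fintype.imageP/andP => [[t + ->]|[bw /forallP rw]].
  rewrite inE => st; split; first exact: word_of_ballot.
  by apply/forallP => i; rewrite rows_word_of_full.
have [t st <-] := word_of_surj bw (fun i => eqP (rw i)).
by exists t.
Qed.

End Tableaux.

(** * Expectations along the growth process *)
Definition diagram (N m : nat) (la : nat -> nat) : Prop :=
  [/\ nonincreasing_rows la, (forall i, (m <= i)%N -> la i = 0%N)
    & (\sum_(i < N) la i)%N = m].

Lemma ballot_diagram N m (w : m.-tuple 'I_N) :
  ballot (letters w) -> diagram N m (rows (letters w)).
Proof.
move=> bw; split; first exact: ballot_rows.
  by move=> i mi; rewrite ballot_rows_eq0 // size_letters.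
by rewrite sum_rows ?letters_lt // size_letters.
Qed.

Lemma rcons_tuple_bij (T : finType) m :
  bijective (fun p : m.-tuple T * T => [tuple of rcons p.1 p.2]).
Proof.
apply: inj_card_bij => [[s x] [s' x'] /= /(congr1 val)/= /rcons_inj[e ->]|].
  by congr (_, _); apply/val_inj.
by rewrite card_prod !card_tuple expnSr.
Qed.

Section Expectation.
Variables (R : realFieldType) (q : R).
Hypotheses (q_gt0 : 0 < q) (q_lt1 : q < 1).

(** The expectation of F at the diagram reached after m steps of the process;
the word lists the rows of the successive boxes. *)
Definition expect (N m : nat) (F : (nat -> nat) -> R) : R :=
  \sum_(w : m.-tuple 'I_N | ballot (letters w))
     weight q N (rows (letters w)) * F (rows (letters w)).

Lemma expect_ext N m F G : (forall la, diagram N m la -> F la = G la) ->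
  expect N m F = expect N m G.
Proof. by move=> FG; apply: eq_bigr => w /ballot_diagram/FG->. Qed.

Lemma expect_le N m F G : (forall la, diagram N m la -> F la <= G la) ->
  expect N m F <= expect N m G.
Proof.
move=> FG; apply: ler_sum => w /ballot_diagram/FG.
by apply: ler_wpM2l; apply: weight_ge0.
Qed.

Lemma expectD N m F G :
  expect N m (fun la => F la + G la) = expect N m F + expect N m G.
Proof. by rewrite -big_split; apply: eq_bigr => w _; rewrite mulrDr. Qed.

Lemma expectZ N m c F : expect N m (fun la => c * F la) = c * expect N m F.
Proof. by rewrite big_distrr; apply: eq_bigr => w _; rewrite mulrCA. Qed.

Lemma expect0 N F : expect N 0 F = F (fun=> 0%N).
Proof.
rewrite /expect (big_pred1 [tuple]) => [|w]; last by rewrite tuple0 /= (eqxx (nil_tuple _)).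
have -> : rows (letters [tuple of Nil 'I_N]) = fun=> 0%N by apply/funext.
by rewrite weight0 mul1r.
Qed.

(** Words whose last letter is not addable are absent on the left and have
probability zero on the right. *)
Lemma expectS N m F :
  expect N m.+1 F =
  expect N m (fun la => \sum_(i < N) growth_prob q N la i * F (add_box la i)).
Proof.
rewrite /expect (reindex _ (onW_bij _ (rcons_tuple_bij _ m))) /=.
have lettersE (p : m.-tuple 'I_N * 'I_N) :
    letters [tuple of rcons p.1 p.2] = rcons (letters p.1) p.2.
  by rewrite /letters /= map_rcons.
rewrite (eq_bigl (fun p : m.-tuple 'I_N * 'I_N =>
  ballot (letters p.1) && addable (rows (letters p.1)) p.2)) => [|p]; last first.
  by rewrite lettersE ballot_rcons.
rewrite (eq_bigr (fun p : m.-tuple 'I_N * 'I_N =>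
   weight q N (add_box (rows (letters p.1)) p.2) *
   F (add_box (rows (letters p.1)) p.2))) => [|p _]; last first.
  by rewrite lettersE rows_rcons.
transitivity (\sum_(w : m.-tuple 'I_N | ballot (letters w))
    \sum_(i < N | addable (rows (letters w)) i)
      weight q N (add_box (rows (letters w)) i) * F (add_box (rows (letters w)) i)).
  by rewrite pair_big_dep.
apply: eq_bigr => w /ballot_diagram[hla _ _].
rewrite big_distrr big_mkcond /=; apply: eq_bigr => i _.
case: ifPn => ai; first by rewrite weight_add_box // mulrA.
by rewrite growth_prob_eq0 // mul0r mulr0.
Qed.

Lemma sum_growth_prob_diagram N m la : (m < N)%N -> diagram N m la ->
  \sum_(i < N) growth_prob q N la i = 1.
Proof.
case: N => // N mN [hla h0 _]; apply: sum_growth_prob1 => //; exact: h0.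
Qed.

Lemma expect1 N m : (m <= N)%N -> expect N m (fun=> 1) = 1.
Proof.
elim: m => [|m IH] mN; first by rewrite expect0.
rewrite expectS -[RHS]IH ?(ltnW mN) //; apply: expect_ext => la hla.
by under eq_bigr do rewrite mulr1; rewrite (sum_growth_prob_diagram mN).
Qed.

Lemma expect_cst N m c : (m <= N)%N -> expect N m (fun=> c) = c.
Proof.
move=> mN; rewrite -[RHS]mulr1 -(expect1 mN) -expectZ.
by apply: expect_ext => la _; rewrite mulr1.
Qed.

Lemma sum_add_box (f : nat -> nat -> R) N la (i : 'I_N) :
  \sum_(j < N) f j (add_box la i j) =
  \sum_(j < N) f j (la j) + (f i (la i).+1 - f i (la i)).
Proof.
rewrite (bigD1 i) //= [in RHS](bigD1 i) //= /add_box eqxx addn1.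
rewrite (eq_bigr (fun j : 'I_N => f j (la j))) => [|j /negPf]; last first.
  by rewrite -val_eqE /= => ->; rewrite addn0.
by ring.
Qed.

Lemma expect_rows_step (f : nat -> nat -> R) N m : (m < N)%N ->
  expect N m.+1 (fun la => \sum_(j < N) f j (la j)) =
  expect N m (fun la => \sum_(j < N) f j (la j)) +
  expect N m (fun la =>
    \sum_(i < N) growth_prob q N la i * (f i (la i).+1 - f i (la i))).
Proof.
move=> mN; rewrite expectS -expectD; apply: expect_ext => la hla.
under eq_bigr do rewrite sum_add_box mulrDr.
by rewrite big_split /= -mulr_suml (sum_growth_prob_diagram mN) // mul1r.
Qed.

Lemma expect_row_index N m : (m <= N)%N ->
  expect N m (fun la => \sum_(j < N) j%:R * (la j)%:R) <= m%:R * (q / (1 - q)).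
Proof.
elim: m => [|m IH] mN; first by rewrite expect0 mul0r big1 // => j _; rewrite mulr0.
rewrite (expect_rows_step (fun j x => j%:R * x%:R)) // -natr1 mulrDl mul1r.
apply: lerD; first exact/IH/ltnW.
rewrite -[leRHS](expect_cst _ (ltnW mN)); apply: expect_le => la [hla h0 _].
case: N mN {IH} h0 => // N mN h0; apply: le_trans (growth_drift_row q_gt0 q_lt1 hla (h0 N _)) => //.
rewrite le_eqVlt; apply/orP; left; apply/eqP; apply: eq_bigr => i _.
by rewrite -natr1; ring.
Qed.

Lemma expect_row_power N m : (m <= N)%N ->
  m%:R / (1 + q) <= expect N m (fun la => \sum_(j < N) q ^+ j * (la j)%:R).
Proof.
elim: m => [|m IH] mN; first by rewrite expect0 mul0r big1 // => j _; rewrite mulr0.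
rewrite (expect_rows_step (fun j x => q ^+ j * x%:R)) // -natr1 mulrDl.
apply: lerD; first exact/IH/ltnW.
rewrite -[leLHS](expect_cst _ (ltnW mN)); apply: expect_le => la [hla h0 _].
case: N mN {IH} h0 => // N mN h0; apply: le_trans (growth_drift_power q_gt0 q_lt1 hla (h0 N _)) _ => //.
rewrite le_eqVlt; apply/orP; left; apply/eqP; apply: eq_bigr => i _.
by rewrite -natr1; ring.
Qed.

Lemma expect_content_drift N m : (m < N)%N ->
  expect N m (content_drift q N) = m%:R * ((1 - q) / (1 + q)).
Proof.
elim: m => [|m IH] mN.
  rewrite expect0 mul0r /content_drift big1 // => -[[|i] iN] _ /=.
    by rewrite subrr mulr0.
  by rewrite growth_prob_eq0 // mul0r.
rewrite expectS -natr1 mulrDl mul1r -IH ?(ltnW mN) //.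
rewrite -[X in _ = _ + X](expect_cst (m := m) _ (ltnW (ltnW mN))) -expectD.
apply: expect_ext => la [hla h0 _].
by case: N mN {IH} h0 => [|[|N]] // mN h0; apply: content_drift_step => //; apply: h0; lia.
Qed.

(** The summand is twice the sum of the contents of row j. *)
Lemma expect_sum_squares N m : (m <= N)%N ->
  expect N m (fun la => \sum_(j < N) ((la j)%:R ^+ 2 - (la j)%:R - 2 * j%:R * (la j)%:R)) =
  m%:R * (m%:R - 1) * ((1 - q) / (1 + q)).
Proof.
elim: m => [|m IH] mN.
  rewrite expect0 !mul0r big1 // => j _; rewrite expr2 !mulr0; ring.
rewrite (expect_rows_step (fun j x => x%:R ^+ 2 - x%:R - 2 * j%:R * x%:R)) //.
rewrite IH ?(ltnW mN) //.
have -> : expect N m (fun la => \sum_(i < N) growth_prob q N la i *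
    ((la i).+1%:R ^+ 2 - (la i).+1%:R - 2 * i%:R * (la i).+1%:R -
    ((la i)%:R ^+ 2 - (la i)%:R - 2 * i%:R * (la i)%:R))) =
    2 * (m%:R * ((1 - q) / (1 + q))).
  rewrite -(expect_content_drift mN) -expectZ; apply: expect_ext => la _.
  rewrite /content_drift big_distrr; apply: eq_bigr => i _ /=.
  by rewrite -natr1; ring.
by rewrite -natr1; ring.
Qed.

Definition row_limit (i : nat) : R := (1 - q) * q ^+ i.

(** After expansion, the expected sum of squares contributes p2 and the cross
term at most - 2 p2, while sum_j x_j^2 <= p2; only terms of order 1/n remain.
The cross term needs just a lower bound on E (sum_j q^j la_j) because row_limit j is
proportional to q^j. *)
Lemma expect_sq_deviation n : (0 < n)%N ->
  expect n n (fun la => \sum_(j < n) ((la j)%:R / n%:R - row_limit j) ^+ 2) <=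
  (1 + 2 * (q / (1 - q))) / n%:R.
Proof.
move=> n0; set p2 := (1 - q) / (1 + q); set rn : R := n%:R.
have rn0 : 0 < rn by rewrite ltr0n.
have rnn : rn != 0 by rewrite gt_eqF.
have q1' : 0 < 1 + q by rewrite addr_gt0.
have p20 : 0 <= p2 by rewrite divr_ge0 ?subr_ge0 // ltW.
have limits : \sum_(j < n) row_limit j ^+ 2 <= p2.
  rewrite ler_pdivlMr //.
  have -> : (\sum_(j < n) row_limit j ^+ 2) * (1 + q) = (1 - q) * (1 - q ^+ n * q ^+ n).
    elim: (n) => [|k IH]; first by rewrite big_ord0 expr0 mul0r mulr1 subrr mulr0.
    by rewrite big_ord_recr /= mulrDl IH /row_limit (exprS q k); ring.
  rewrite ler_piMr ?subr_ge0 ?gerBl ?mulr_ge0 ?exprn_ge0 //; exact: ltW.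
rewrite (expect_ext (G := fun la =>
    rn^-1 ^+ 2 * (\sum_(j < n) ((la j)%:R ^+ 2 - (la j)%:R - 2 * j%:R * (la j)%:R))
    + (rn^-1 + \sum_(j < n) row_limit j ^+ 2)
    + 2 * rn^-1 ^+ 2 * (\sum_(j < n) j%:R * (la j)%:R)
    + (- (2 * (1 - q) / rn)) * (\sum_(j < n) q ^+ j * (la j)%:R))); last first.
  move=> la [_ _ sla].
  have e : rn^-1 = rn^-1 ^+ 2 * \sum_(j < n) (la j)%:R.
    by rewrite -natr_sum sla -/rn; field.
  rewrite [X in _ + (X + _)]e {e}.
  rewrite !big_distrr /= -!big_split /=; apply: eq_bigr => j _.
  by rewrite /row_limit; field.
rewrite !expectD !expectZ expect_cst // expect_sum_squares // -/rn -/p2.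
have h1 := expect_row_index (leqnn n); have h2 := expect_row_power (leqnn n).
rewrite -/rn in h1 h2.
set B := expect n n _ in h1 *; set Q := expect n n _ in h2 *.
apply: (@le_trans _ _ (rn^-1 ^+ 2 * (rn * (rn - 1) * p2) + (rn^-1 + p2)
   + 2 * rn^-1 ^+ 2 * (rn * (q / (1 - q))) + - (2 * (1 - q) / rn) * (rn / (1 + q)))).
  apply: lerD; last first.
    by rewrite !mulNr lerN2 ler_wpM2l // !mulr_ge0 ?subr_ge0 ?invr_ge0 // ltW.
  apply: lerD; last by rewrite ler_wpM2l // mulr_ge0 // exprn_ge0 // invr_ge0 ltW.
  by rewrite !lerD2l expect_cst.
have -> : rn^-1 ^+ 2 * (rn * (rn - 1) * p2) + (rn^-1 + p2)
   + 2 * rn^-1 ^+ 2 * (rn * (q / (1 - q))) + - (2 * (1 - q) / rn) * (rn / (1 + q))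
   = (1 + 2 * (q / (1 - q))) / rn - p2 / rn.
  rewrite /p2; field; rewrite rnn !gt_eqF // ?subr_gt0 //.
by rewrite gerBl divr_ge0 // ltW.
Qed.

End Expectation.

(** * The q-Plancherel measure as the law of the growth process *)
Section Bridge.
Variable n : nat.

Lemma prod_box (R : comRingType) (la : young n) (f : nat -> nat -> R) :
  \prod_(c : box la) f (row_of c) (col_of c) =
  \prod_(i < n) \prod_(j < part la i) f i j.
Proof.
have := big_sub (op := *%R) (fun c : 'I_n * 'I_n => (c.2 < part la c.1)%N) (fun c => f c.1 c.2).
move=> <-.
rewrite -(pair_big_dep xpredT (fun i j : 'I_n => (j < part la i)%N) (fun i j : 'I_n => f i j)) /=.
apply: eq_bigr => i _; rewrite (big_ord_widen n (fun j => f i j)) //.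
exact: part_leq.
Qed.

Lemma q_plancherelE (R : realType) (q : R) (la : young n) : 0 < q -> q < 1 ->
  q_plancherel q la = (dim_young la)%:R * weight q n (part la).
Proof.
move=> q0 q1; rewrite /q_plancherel /weight; congr (_ * _).
have q1' : 1 - q != 0 by rewrite subr_eq0 gt_eqF.
have qnumE m : qnum q m = (1 - q)^-1 * (1 - q ^+ m).
  by rewrite /qnum -opprB -[q - 1]opprB invrN mulrNN mulrC.
rewrite (eq_bigr (fun c : box la => (1 - q)^-1 * (1 - q ^+ hook n (part la) (row_of c) (col_of c))))
  => [|c _]; last exact: qnumE.
rewrite big_split /= prodr_const card_box.
rewrite (prod_box la (fun i j => 1 - q ^+ hook n (part la) i j)).
rewrite sum_part prodf_div expr_sum exprVn invfM invrK.
by rewrite mulrCA.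
Qed.

Lemma diagram_young la : diagram n n la -> exists mu : young n, part mu = la.
Proof.
move=> [hla h0 sla].
have lan i : (la i <= n)%N.
  have [ni|ni] := ltnP i n; last by rewrite h0.
  by rewrite -[leqRHS]sla (bigD1 (Ordinal ni)) //= leq_addr.
pose t : n.-tuple 'I_n.+1 := mktuple (fun i => inord (la i)).
have tE : [seq nat_of_ord x | x <- t] = mkseq la n.
  apply: (@eq_from_nth _ 0%N); first by rewrite size_map size_tuple size_mkseq.
  move=> i; rewrite size_map size_tuple => ni.
  rewrite (nth_map ord0) ?size_tuple // nth_mkseq //.
  by rewrite -[i]/(val (Ordinal ni)) -tnth_nth tnth_mktuple inordK // ltnS.
have tp : is_partition t.
  rewrite /is_partition tE; apply/andP; split.
    apply/(sortedP 0%N) => i; rewrite size_mkseq => ni.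
    by rewrite !nth_mkseq ?(ltnW ni) //; exact: hla.
  rewrite -[X in _ == X]sla sumnE big_map -(big_mkord xpredT la) /index_iota subn0.
  by apply/eqP.
exists (exist _ t tp); apply/funext => i; rewrite /part /= tE.
have [ni|ni] := ltnP i n; first by rewrite nth_mkseq.
by rewrite nth_default ?size_mkseq // h0.
Qed.

Lemma part_inj (la mu : young n) : part la = part mu -> la = mu.
Proof.
move=> e; apply/val_inj/val_inj/(inj_map val_inj).
apply: (@eq_from_nth _ 0%N); first by rewrite !size_map !size_tuple.
by move=> i _; exact: (congr1 (fun f => f i) e).
Qed.

(** Each standard tableau of shape la is a ballot word of shape la, and all these
words carry the same weight; every ballot word has exactly one shape. *)
Lemma q_plancherel_expect (R : realType) (q : R) (F : (nat -> nat) -> R) :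
  0 < q -> q < 1 ->
  \sum_(la : young n) q_plancherel q la * F (part la) = expect q n n F.
Proof.
move=> q0 q1.
transitivity (\sum_(la : young n) \sum_(w : n.-tuple 'I_n |
   ballot (letters w) && [forall i : 'I_n, rows (letters w) i == part la i])
   weight q n (rows (letters w)) * F (rows (letters w))).
  apply: eq_bigr => la _.
  rewrite (eq_bigr (fun=> weight q n (part la) * F (part la))) => [|w].
    by rewrite sumr_const q_plancherelE // dim_young_ballot mulr_natl mulrnAl.
  case/andP => bw /forallP rw; suff -> : rows (letters w) = part la by [].
  apply/funext => i; have [ni|ni] := ltnP i n; first exact/eqP/(rw (Ordinal ni)).
  by rewrite part_eq0 // ballot_rows_eq0 // size_letters.
rewrite (exchange_big_dep (fun w => ballot (letters w))) /= => [|la w _ /andP[]//].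
apply: eq_bigr => w bw; have [mu muw] := diagram_young (ballot_diagram bw).
rewrite (big_pred1 mu) // => la /=; rewrite bw /=; apply/forallP/eqP => [h|-> i].
  apply: part_inj; rewrite muw; apply/funext => i.
  have [ni|ni] := ltnP i n; first by rewrite (eqP (h (Ordinal ni))).
  by rewrite part_eq0 // ballot_rows_eq0 // size_letters.
by rewrite muw.
Qed.

End Bridge.

Theorem theorem1 (R : realType) (q : R) (hq0 : 0 < q) (hq1 : q < 1)
    (i : nat) (hi : (1 <= i)%N) :
  cvg_in_q_plancherel q
    (fun (n : nat) (la : young n) => (part la i.-1)%:R / n%:R)
    ((1 - q) * q ^+ i.-1).
Proof.
move=> delta delta0; set k := i.-1; set K := 1 + 2 * (q / (1 - q)).
have q_plancherel_ge0 n (la : young n) : 0 <= q_plancherel q la.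
  by rewrite q_plancherelE // mulr_ge0 // weight_ge0.
apply: (@squeeze_cvgr _ _ _ _ (fun=> 0) (fun n : nat => K / delta ^+ 2 * n%:R^-1)).
- near=> n; apply/andP; split; first by apply: sumr_ge0.
  have kn : (k < n)%N by near: n; exact: nbhs_infty_gt.
  have n0 : (0 < n)%N by apply: leq_ltn_trans kn.
  rewrite mulrAC ler_pdivlMr ?exprn_gt0 //.
  (* Chebyshev: delta^2 is at most the square of the deviation of row k. *)
  apply: le_trans (expect_sq_deviation hq0 hq1 n0).
  rewrite -q_plancherel_expect // /q_plancherel_pr mulr_suml big_mkcond /=.
  apply: ler_sum => la _; case: ifPn => [dla|_]; last first.
    by rewrite mulr_ge0 // sumr_ge0 // => j _; exact: sqr_ge0.
  apply: ler_wpM2l => //; rewrite (bigD1 (Ordinal kn)) //=.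
  apply: ler_wpDr; first by apply: sumr_ge0 => j _; exact: sqr_ge0.
  by rewrite -[leRHS]real_normK ?num_real // lerXn2r // nnegrE ltW.
- exact: cvg_cst.
rewrite -[X in _ --> X](mulr0 (K / delta ^+ 2)); apply: cvgM; first exact: cvg_cst.
by rewrite -cvg_shiftS; exact: cvg_harmonic.
Unshelve. all: by end_near.
Qed.
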